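(* A word $p\in\{0,1\}^*$ is a binary pattern encountered by the period-doubling word $\mathbf{d}$ if and only if one of the following holds: 1. For at least one $q\in\{p,\overline{p}\}$, at least one of the words $q$, $h_1(q)$, $h_2(q)$ is a factor of $\mathbf{d}$. 2. One of $p$ and $\overline{p}$ is among $0010100$, $01001001000$, $00100100100$, $001001001000$, $00010010010$, $000100100100$, $0010001000100$, $00100010001000$, $00010001000100$, and $000100010001000$. The two possibilities are mutually exclusive.
   Context: The period-doubling word $\mathbf{d}=01000101010001000100010101000101\cdots$ is the one-sided infinite fixed point, beginning with $0$, of the morphism $\delta$ with $\delta(0)=01$, $\delta(1)=00$. A factor of a word is a finite contiguous subword. A word $w$ encounters a binary pattern $p\in\{0,1\}^*$ if $g(p)$ is a factor of $w$ for some non-erasing morphism $g:\{0,1\}^*\to\{0,1\}^*$ (i.e. $g(0),g(1)$ non-empty). $\overline{p}$ is the binary complement of $p$ (exchange $0$ and $1$). The morphisms $h_1,h_2$ are $h_1(0)=0$, $h_1(1)=01$ and $h_2(0)=0$, $h_2(1)=10$. *)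

(* Defs.v *)
From mathcomp Require Import all_boot.

Set Implicit Arguments.
Unset Strict Implicit.
Unset Printing Implicit Defensive.

(* The alphabet {0,1} is [bool], with 0 = false and 1 = true. *)
Declare Scope letter_scope.
Delimit Scope letter_scope with L.
Notation "0" := false (only parsing) : letter_scope.
Notation "1" := true (only parsing) : letter_scope.

Definition word := seq bool.
Definition infword := nat -> bool.

(* A morphism of {0,1}^* is given by its values on the two letters. *)
Definition morphism := bool -> word.

Definition apply (g : morphism) (w : word) : word := flatten (map g w).

Definition nonerasing (g : morphism) : Prop := forall a, g a <> [::].

Definition complement (w : word) : word := map negb w.

Definition factor (w : word) (x : infword) : Prop :=
  exists i, w = mkseq (fun k => x (i + k)) (size w).

Definition encounters (x : infword) (p : word) : Prop :=
  exists2 g : morphism, nonerasing g & factor (apply g p) x.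

(* For a non-erasing g, this says that the infinite word g(x) equals x. *)
Definition fixed_point (g : morphism) (x : infword) : Prop :=
  forall n, apply g (mkseq x n) = mkseq x (size (apply g (mkseq x n))).

Definition delta : morphism := fun a => if a then [:: 0; 0]%L else [:: 0; 1]%L.
Definition h1 : morphism := fun a => if a then [:: 0; 1]%L else [:: 0]%L.
Definition h2 : morphism := fun a => if a then [:: 1; 0]%L else [:: 0]%L.

(* The words delta^n(0) have length 2^n > n and are prefixes of one another;
   [period_doubling] is their limit.  By [period_doublingP] below it is the
   unique fixed point of delta beginning with 0. *)
Definition period_doubling : infword :=
  fun n => nth 0%L (iter n (apply delta) [:: 0]%L) n.

Definition exceptional_patterns : seq word :=
  [:: [:: 0; 0; 1; 0; 1; 0; 0];
      [:: 0; 1; 0; 0; 1; 0; 0; 1; 0; 0; 0];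
      [:: 0; 0; 1; 0; 0; 1; 0; 0; 1; 0; 0];
      [:: 0; 0; 1; 0; 0; 1; 0; 0; 1; 0; 0; 0];
      [:: 0; 0; 0; 1; 0; 0; 1; 0; 0; 1; 0];
      [:: 0; 0; 0; 1; 0; 0; 1; 0; 0; 1; 0; 0];
      [:: 0; 0; 1; 0; 0; 0; 1; 0; 0; 0; 1; 0; 0];
      [:: 0; 0; 1; 0; 0; 0; 1; 0; 0; 0; 1; 0; 0; 0];
      [:: 0; 0; 0; 1; 0; 0; 0; 1; 0; 0; 0; 1; 0; 0];
      [:: 0; 0; 0; 1; 0; 0; 0; 1; 0; 0; 0; 1; 0; 0; 0]]%L.

Lemma size_apply_delta (w : word) : size (apply delta w) = (size w).*2.
Proof. by elim: w => //= -[] w IH; rewrite /apply /= -/(apply _ _) IH doubleS. Qed.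

Lemma nth_apply_delta (w : word) n : n < (size w).*2 ->
  nth 0%L (apply delta w) n = odd n && ~~ nth 0%L w n./2.
Proof.
elim: w n => [|a w IH] [|[|n]] //=; rewrite /apply /= -/(apply _ _).
- by case: a.
- by case: a.
- rewrite doubleS !ltnS => lt_n; rewrite negbK -IH //; by case: a.
Qed.

Lemma size_iter_delta n : size (iter n (apply delta) [:: 0]%L) = 2 ^ n.
Proof. by elim: n => //= n IH; rewrite size_apply_delta IH expnS mul2n. Qed.

Lemma nth_iter_delta m n k : k < 2 ^ m -> k < 2 ^ n ->
  nth 0%L (iter m (apply delta) [:: 0]%L) k =
  nth 0%L (iter n (apply delta) [:: 0]%L) k.
Proof.
elim: m n k => [|m IH] [|n] k //=.
- case: k => // _ _.
  by rewrite nth_apply_delta // size_iter_delta double_gt0 expn_gt0.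
- case: k => // _ _.
  by rewrite nth_apply_delta // size_iter_delta double_gt0 expn_gt0.
rewrite !expnS !mul2n => km kn.
rewrite !nth_apply_delta ?size_iter_delta //.
by congr (_ && ~~ _); apply: IH; rewrite ltn_half_double.
Qed.

Lemma period_doublingE n :
  period_doubling n = odd n && ~~ period_doubling n./2.
Proof.
rewrite /period_doubling.
have lt2 k : k < 2 ^ k by apply: ltn_expl.
have lt_n : n < (2 ^ n).*2 by rewrite -addnn ltn_addl.
rewrite (@nth_iter_delta n n.+1) ?expnS ?mul2n //=.
rewrite nth_apply_delta ?size_iter_delta //.
by congr (_ && ~~ _); apply: nth_iter_delta => //; rewrite ltn_half_double.
Qed.

Lemma delta_fixed_pointP (x : infword) :
  fixed_point delta x <-> forall n, x n = odd n && ~~ x n./2.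
Proof.
split=> [fix_x n | x_rec n].
  have lt_n : n < n.+1.*2 by rewrite doubleS ltnS -addnn leqW ?leq_addr.
  have := fix_x n.+1; rewrite size_apply_delta size_mkseq.
  move/(congr1 (nth 0%L ^~ n)); rewrite nth_apply_delta ?size_mkseq //.
  by rewrite !nth_mkseq ?ltn_half_double.
apply: (@eq_from_nth _ 0%L); rewrite ?size_mkseq // => i.
rewrite size_apply_delta size_mkseq => lt_i.
rewrite nth_apply_delta ?size_mkseq // !nth_mkseq ?ltn_half_double //.
Qed.

Lemma period_doublingP (x : infword) :
  (fixed_point delta x /\ x 0 = 0%L) <-> x =1 period_doubling.
Proof.
split=> [[/delta_fixed_pointP x_rec x0] n | eq_x].
  elim/ltn_ind: n => -[_|n IH]; first by rewrite x0.
  rewrite x_rec period_doublingE IH //.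
  by rewrite ltn_half_double doubleS !ltnS -addnn leq_addr.
by split=> [|]; [apply/delta_fixed_pointP=> n|]; rewrite !eq_x // {1}period_doublingE.
Qed.

(* Main.v *)
(** Every 1 of d sits at an odd position, so a word containing 1 occurs only at
    positions of one parity, and an occurrence of g(p) with both |g(0)|, |g(1)|
    even desubstitutes through delta to a shorter one.  Hence, up to
    complementing p, |g(0)| is odd.  If g(0) contains 1, or if g(0) = 000, the
    parities leave only finitely many p.  If g(0) = 0 and v = g(1) contains 1 but
    is not 1, 01 or 10, then all occurrences of v agree modulo 4 unless v is
    alternating, and since 0000 is not a factor all gaps between consecutive 1s of
    p are equal.  As d has no fourth power, p is again confined to a finite
    set, which is settled by enumerating the words that avoid a few forbidden
    factors.  The values v = 1, 01, 10 give the three factor conditions. *)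

Require Import Defs.
From mathcomp Require Import all_boot.
From mathcomp Require Import zify.

Set Implicit Arguments.
Unset Strict Implicit.
Unset Printing Implicit Defensive.

Local Notation d := period_doubling.

(** * Parity and occurrences in the period-doubling word *)

Lemma d_even n : ~~ odd n -> d n = false.
Proof. by rewrite period_doublingE => /negbTE ->. Qed.

Lemma d_odd n : odd n -> d n = ~~ d n./2.
Proof. by move=> on; rewrite period_doublingE on. Qed.

Lemma d_true_odd n : d n -> odd n.
Proof. by apply: contraTT => /d_even ->. Qed.

(** A boolean, letter-by-letter form of occurrence at [s], so that concrete words unfold by
    computation. *)
Fixpoint occ (w : word) (s : nat) : bool :=
  if w is a :: w' then (d s == a) && occ w' s.+1 else true.

Lemma occE w s : occ w s = (w == mkseq (fun k => d (s + k)) (size w)).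
Proof.
elim: w s => //= a w IH s; rewrite IH /mkseq /= addn0 eqseq_cons eq_sym.
rewrite -[1]/(1 + 0) iotaDl -map_comp.
by congr (_ && (w == _)); apply: eq_map => k /=; rewrite addnS.
Qed.

Lemma factorP w : factor w d <-> exists s, occ w s.
Proof.
by split=> -[s] => [/eqP|occ_w]; exists s; [rewrite occE|apply/eqP; rewrite -occE].
Qed.

Lemma occ_cat x y s : occ (x ++ y) s = occ x s && occ y (s + size x).
Proof. by elim: x s => [|a x IH] s /=; rewrite ?addn0 // IH addSnnS andbA. Qed.

Lemma occ_nth w s j : occ w s -> j < size w -> d (s + j) = nth false w j.
Proof.
elim: w s j => //= a w IH s [|j] /andP[/eqP <- occ_w] lt_j; first by rewrite addn0.
by rewrite addnS -addSn IH.
Qed.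

Lemma occ_parity w s t : true \in w -> occ w s -> occ w t -> odd s = odd t.
Proof.
move=> /(nthP false)[j lt_j w_j] occ_s occ_t.
have := occ_nth occ_s lt_j; have := occ_nth occ_t lt_j; rewrite w_j.
by move=> /d_true_odd + /d_true_odd; rewrite !oddD; case: (odd s) (odd t) (odd j) => [] [] [].
Qed.

(** A 0 at odd s comes from a 1 at s/2, so s/2 is odd; then s/2 + 1 is even and carries a 0, whose
    image puts a 1 at s + 2. *)
Lemma no_two_odd_zeros s : odd s -> d s || d s.+2.
Proof.
move=> odd_s; rewrite (d_odd odd_s) (@d_odd s.+2) /= ?negbK //.
case: (boolP (d s./2)) => //= /d_true_odd odd_h.
by rewrite (@d_even s./2.+1) /= ?negbK // orbT.
Qed.

Lemma no_four_zeros s : [|| d s, d s.+1, d s.+2 | d s.+3].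
Proof.
have [odd_s|even_s] := boolP (odd s).
  by case/orP: (no_two_odd_zeros odd_s) => ->; rewrite ?orbT.
by case/orP: (@no_two_odd_zeros s.+1 even_s) => ->; rewrite ?orbT.
Qed.

Lemma zero_run w s : true \notin w -> occ w s -> size w <= 3.
Proof.
case: w => [|a [|b [|c [|e w]]]] //=; rewrite !inE !negb_or.
case/and5P=> a0 b0 c0 e0 _ /and5P[/eqP da /eqP db /eqP dc /eqP de _].
have := no_four_zeros s; rewrite da db dc de.
by case: a b c e a0 b0 c0 e0 {da db dc de} => [] [] [] [].
Qed.

(* [undelta (~~ odd s) w] is the preimage under delta of an occurrence of w at s:
   the letters of w at odd positions of the period-doubling word, complemented. *)
Fixpoint undelta (b : bool) (w : word) : word :=
  match w with
  | x :: y :: w' => ~~ (if b then y else x) :: undelta b w'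
  | [:: x] => if b then [::] else [:: ~~ x]
  | [::] => [::]
  end.

Lemma seq_ind2 (P : word -> Prop) :
  P [::] -> (forall a, P [:: a]) -> (forall a b w, P w -> P [:: a, b & w]) ->
  forall w, P w.
Proof.
move=> P0 P1 P2 w; suff: P w /\ forall a, P (a :: w) by case.
by elim: w => [|a w [Pw Paw]]; split=> // b; apply: P2.
Qed.

Lemma size_undelta b w : ~~ odd (size w) -> size (undelta b w) = (size w)./2.
Proof. by elim/seq_ind2: w => //= x y w IH; rewrite negbK => /IH ->. Qed.

Lemma undelta_cat b x y : ~~ odd (size x) -> undelta b (x ++ y) = undelta b x ++ undelta b y.
Proof. by elim/seq_ind2: x => //= a a' x IH; rewrite negbK => /IH ->. Qed.

Lemma occ_undelta w s : occ w s -> occ (undelta (~~ odd s) w) s./2.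
Proof.
elim/seq_ind2: w s => // [x|x y w IH] s /=.
  have [odd_s|//] := boolP (odd s).
  by rewrite (d_odd odd_s) /= => /andP[/eqP <- _]; rewrite negbK eqxx.
case/and3P=> [/eqP ds /eqP ds1 /IH /=].
rewrite negbK => ->; rewrite andbT.
have [os|es] := boolP (odd s); first by rewrite -ds (d_odd os) negbK eqxx.
by rewrite -ds1 (d_odd (n := s.+1)) //= negbK uphalf_half (negbTE es) add0n eqxx.
Qed.

(** An even-length x desubstitutes to a shorter fourth power. For odd length, a 1 in x would occur
    at positions of both parities, and without a 1 there is a run of at least four zeros. *)
Lemma no_fourth_power (x : word) s : x != [::] -> ~~ occ (x ++ x ++ x ++ x) s.
Proof.
have [n] := ubnP (size x); elim: n x s => // n IH x s lt_x nx; apply/negP => occ4.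
have sx : 0 < size x by rewrite lt0n size_eq0.
have [odd_x|even_x] := boolP (odd (size x)); last first.
  have := occ_undelta occ4; rewrite !undelta_cat //; apply/negP/IH.
    by rewrite size_undelta; lia.
  by rewrite -size_eq0 size_undelta; lia.
have [x1|x0] := boolP (true \in x).
  move: occ4; rewrite !occ_cat => /and4P[o1 o2 _ _].
  by have := occ_parity x1 o1 o2; rewrite oddD odd_x; case: odd.
have : size (x ++ x ++ x ++ x) <= 3.
  by apply: zero_run occ4; rewrite !mem_cat !negb_or x0.
by rewrite !size_cat; lia.
Qed.

(** * Reduction to a morphism with an image of odd length *)

Lemma apply_cat g x y : apply g (x ++ y) = apply g x ++ apply g y.
Proof. by rewrite /apply map_cat flatten_cat. Qed.

Lemma occ_infix g l p s :
  occ (apply g p) s -> infix l p -> exists t, occ (apply g l) t.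
Proof.
move=> occ_p /infixP[x [y def_p]]; move: occ_p; rewrite def_p !apply_cat !occ_cat.
by case/and3P=> _ occ_l _; eexists; apply: occ_l.
Qed.

Lemma apply_complement g p : apply (g \o negb) (complement p) = apply g p.
Proof.
by rewrite /apply /complement -map_comp; congr flatten; apply: eq_map => a /=; rewrite negbK.
Qed.

Lemma complementK : involutive complement.
Proof. exact/mapK/negbK. Qed.

(** When both images have even length, all blocks of g(p) start at the same parity, so [undelta]
    with one fixed phase acts on each image separately and halves it. *)
Lemma encounters_reduced p : encounters d p ->
  exists g s, [/\ nonerasing g, occ (apply g p) s & exists a, odd (size (g a))].
Proof.
case=> g ne /factorP[s]; have [n] := ubnP (size (g false) + size (g true)).
elim: n g ne s => // n IH g ne s lt_n occ_p.
have [odd0|even0] := boolP (odd (size (g false))).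
  by exists g, s; split=> //; exists false.
have [odd1|even1] := boolP (odd (size (g true))).
  by exists g, s; split=> //; exists true.
have even a : ~~ odd (size (g a)) by case: a.
have pos a : 0 < size (g a) by rewrite lt0n size_eq0; apply/eqP/ne.
apply: (IH (undelta (~~ odd s) \o g) _ s./2).
- move=> a /(congr1 size) /=; rewrite size_undelta //.
  by have := pos a; have := even a; lia.
- by rewrite /= !size_undelta; have := pos true; have := pos false; lia.
have -> : apply (undelta (~~ odd s) \o g) p = undelta (~~ odd s) (apply g p).
  by elim: p {occ_p IH} => //= a p; rewrite /apply /= => ->; rewrite undelta_cat.
exact: occ_undelta.
Qed.

(** * Deciding the conclusion by finite enumeration *)

Definition tame (p : word) : Prop :=
  (exists2 q : word, q = p \/ q = complement p &
     [\/ factor q d, factor (apply h1 q) d | factor (apply h2 q) d])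
  \/ (p \in exceptional_patterns \/ complement p \in exceptional_patterns).

Lemma tame_complement p : tame (complement p) -> tame p.
Proof.
rewrite /tame complementK => -[[q eq_q fq]|exc]; last by right; case: exc; auto.
by left; exists q => //; case: eq_q; auto.
Qed.

Definition short_prefix : word := iter 6 (apply delta) [:: false].

Lemma infix_factor w : infix w short_prefix -> factor w d.
Proof.
have size_pre : size short_prefix = 2 ^ 6 by apply: size_iter_delta.
have occ_pre : occ short_prefix 0.
  rewrite occE size_pre; apply/eqP/(@eq_from_nth _ false) => [|i].
    by rewrite size_mkseq.
  rewrite size_pre => lt_i; rewrite [RHS]nth_mkseq //.
  by rewrite add0n; apply: nth_iter_delta => //; apply: ltn_expl.
case/infixP=> x [y def_P]; apply/factorP; exists (size x).
by move: occ_pre; rewrite def_P !occ_cat add0n => /and3P[].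
Qed.

(** A sufficient test only: factors are looked for in the first 64 letters of d. *)
Definition tameb (p : word) : bool :=
  has (fun q => has (fun w => infix w short_prefix) [:: q; apply h1 q; apply h2 q])
      [:: p; complement p]
  || (p \in exceptional_patterns) || (complement p \in exceptional_patterns).

Lemma tamebP p : tameb p -> tame p.
Proof.
case/orP=> [/orP[/hasP[q]|]|]; try by move=> *; right; auto.
rewrite !inE => eq_q in_q; left; exists q.
  by case/orP: eq_q => /eqP; auto.
by case/hasP: in_q => w; rewrite !inE => /or3P[] /eqP-> /infix_factor; 
  [apply: Or31|apply: Or32|apply: Or33].
Qed.

Definition avoids (L : seq word) (w : word) : bool := ~~ has (fun l => infix l w) L.

Fixpoint avoiding (L : seq word) (n : nat) : seq word :=
  if n is n'.+1 then
    [seq w <- [seq a :: w | a <- [:: false; true], w <- avoiding L n'] | avoids L w]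
  else [:: [::]].

Lemma avoids_catr L x y : avoids L (x ++ y) -> avoids L y.
Proof.
move=> /hasPn av; apply/hasPn => l /av; apply: contra => /infixP[u [v ->]].
by apply/infixP; exists (x ++ u), v; rewrite -catA.
Qed.

Lemma mem_avoiding L w : avoids L w -> w \in avoiding L (size w).
Proof.
elim: w => // a w IH av; rewrite mem_filter av /=.
have /IH in_w := @avoids_catr L [:: a] w av.
by rewrite cats0 mem_cat; case: a {av}; rewrite map_f ?orbT.
Qed.

(** Avoidance passes to suffixes, so if no word of length n avoids L, then every avoiding word is
    shorter than n and falls under the computed check. *)
Lemma avoids_tame L n p :
  all (fun k => all tameb (avoiding L k)) (iota 0 n) && nilp (avoiding L n) ->
  avoids L p -> tame p.
Proof.
case/andP=> /allP all_tame /nilP nil_n av_p.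
have lt_p : size p < n.
  rewrite ltnNge; apply/negP => le_n.
  have := @avoids_catr L (take (size p - n) p) (drop (size p - n) p).
  rewrite cat_take_drop => /(_ av_p) /mem_avoiding.
  by rewrite size_drop subKn // nil_n.
apply/tamebP/(allP (all_tame (size p) _)); last exact: mem_avoiding.
by rewrite mem_iota.
Qed.

Lemma avoids_cons l L p : ~~ infix l p -> avoids L p -> avoids (l :: L) p.
Proof. by rewrite /avoids /= negb_or => ->. Qed.

(** * Factors that a pattern cannot contain *)

Lemma not_infix g p s l : occ (apply g p) s ->
  (forall t, ~~ occ (apply g l) t) -> ~~ infix l p.
Proof. by move=> occ_p no_l; apply/negP => /(occ_infix occ_p)[t]; apply/negP. Qed.

Lemma repeat_even g a x t :
  true \in g a -> occ (apply g (a :: x ++ [:: a])) t ->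
  ~~ odd (size (apply g (a :: x))).
Proof.
move=> ga1; rewrite -cat_cons apply_cat {2}/apply /= cats0 occ_cat.
case/andP=> + o2; rewrite {1}/apply /= occ_cat => /andP[o1 _].
by have := occ_parity ga1 o1 o2; rewrite oddD; case: (odd t) (odd (size _)) => [] [].
Qed.

Lemma no_odd_repeat g a x t :
  true \in g a -> odd (size (apply g (a :: x))) ->
  ~~ occ (apply g (a :: x ++ [:: a])) t.
Proof. by move=> ga1 odd_x; apply/negP => /(repeat_even ga1); rewrite odd_x. Qed.

Lemma no_fourth_power_apply g x t :
  nonerasing g -> x != [::] -> ~~ occ (apply g (x ++ x ++ x ++ x)) t.
Proof.
move=> ne nx; rewrite !apply_cat; apply: no_fourth_power.
by case: x nx => // a x _; rewrite /apply /=; case: (g a) (ne a).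
Qed.

(** The letters of p alternate, and excluding the fourth powers of 01 and 10 leaves length at most
    7. *)
Lemma tame_alternating g p s : nonerasing g -> occ (apply g p) s ->
  (forall a t, ~~ occ (apply g [:: a; a]) t) -> tame p.
Proof.
move=> ne occ_p alt.
apply: (@avoids_tame [:: [:: false; false]; [:: true; true];
  [:: false; true; false; true; false; true; false; true];
  [:: true; false; true; false; true; false; true; false]] 8).
  by vm_compute.
do !apply: avoids_cons; rewrite //; apply: (not_infix occ_p) => t.
- exact: alt.
- exact: alt.
- exact: (@no_fourth_power_apply g [:: false; true]).
- exact: (@no_fourth_power_apply g [:: true; false]).
Qed.

(** If |g(1)| is odd too, neither letter can be doubled. If it is even, two 0s of p separated only
    by 1s would put g(0) at an odd distance from itself, so p has at most one 0. *)
Lemma tame_both_true g p s : nonerasing g -> occ (apply g p) s ->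
  true \in g false -> odd (size (g false)) ->
  (odd (size (g true)) -> true \in g true) -> tame p.
Proof.
move=> ne occ_p g01 odd0 g11.
have no_rep x t : ~~ odd (size (apply g x)) -> ~~ occ (apply g (false :: x ++ [:: false])) t.
  by move=> ex; apply: no_odd_repeat; rewrite // /apply /= size_cat oddD odd0.
have [odd1|even1] := boolP (odd (size (g true))).
  apply: (tame_alternating ne occ_p) => a t.
  by apply: (@no_odd_repeat g a [::]); rewrite /apply /= ?cats0; case: a; auto.
apply: (@avoids_tame [:: [:: false; false]; [:: false; true; false];
  [:: false; true; true; false]; [:: false; true; true; true; false];
  [:: true; true; true; true]] 8).
  by vm_compute.
do !apply: avoids_cons; rewrite //; apply: (not_infix occ_p) => t.
- by apply: (no_rep [::]).
- by apply: (no_rep [:: true]); rewrite /apply /= cats0.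
- by apply: (no_rep [:: true; true]); rewrite /apply /= cats0 size_cat oddD addbb.
- apply: (no_rep [:: true; true; true]).
  by rewrite /apply /= cats0 !size_cat !oddD addbb addbF.
- by apply: (@no_fourth_power_apply g [:: true]).
Qed.

(** * Gaps between consecutive 1s of p when g(0) = 0 *)

Lemma apply_nseq0 g n : g false = [:: false] -> apply g (nseq n false) = nseq n false.
Proof. by move=> g0; elim: n => //= n IH; rewrite /apply /= g0 -/(apply g _) IH. Qed.

Lemma d_head w t : head false w -> occ w t -> d t.
Proof. by case: w => //= a w -> /andP[/eqP]. Qed.

Lemma head_after_zeros v t :
  v != [::] -> occ ([:: false; false; false] ++ v) t -> head false v.
Proof.
case: v => [|[] v] //= _ /and5P[/eqP d0 /eqP d1 /eqP d2 /eqP d3 _].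
by have := no_four_zeros t; rewrite d0 d1 d2 d3.
Qed.

Lemma last_before_zeros v t :
  v != [::] -> occ (v ++ [:: false; false; false]) t -> last false v.
Proof.
case/lastP: v => [|v a] // _; rewrite last_rcons cat_rcons occ_cat => /andP[_].
case: a => //= /and5P[/eqP d0 /eqP d1 /eqP d2 /eqP d3 _].
by have := no_four_zeros (t + size v); rewrite d0 d1 d2 d3.
Qed.

Lemma odd_between_ones v t : occ v t -> head false v -> last false v -> odd (size v).
Proof.
case/lastP: v => // v b; rewrite last_rcons => occ_v head_v b1.
have dl : d (t + size v).
  by rewrite (occ_nth occ_v) ?size_rcons // nth_rcons ltnn eqxx.
by move: (d_true_odd dl) (d_true_odd (d_head head_v occ_v)); rewrite size_rcons; lia.
Qed.

(** If c < c', parity and the absence of 0000 force c' = c + 2. Then v occurs at two positions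
    differing by 2 modulo 4, which puts a 1 at every odd position covered by v. The word v 0^c v
    inherits this and is long enough to desubstitute to a word containing 0000. *)
Lemma gap_le (v : word) c c' s s' :
  true \in v -> v \notin [:: [:: true]; [:: false; true]; [:: true; false]] ->
  occ (v ++ nseq c false ++ v) s -> occ (v ++ nseq c' false ++ v) s' -> c' <= c.
Proof.
move=> v1 nv; rewrite !occ_cat !size_nseq => /and3P[o1 _ o2] /and3P[o3 oz o4].
rewrite leqNgt; apply/negP => lt_c.
have c'3 : c' <= 3.
  have := zero_run _ oz; rewrite size_nseq; apply.
  by rewrite mem_nseq andbF.
have p12 := occ_parity v1 o1 o2; have p13 := occ_parity v1 o1 o3.
have p34 := occ_parity v1 o3 o4.
have even_c : ~~ odd (size v + c) by move: p12; clear; lia.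
have even_c' : ~~ odd (size v + c') by move: p34; clear; lia.
have c'E : c' = c.+2 by move: even_c even_c' lt_c c'3; clear; lia.
(* The even distances |v| + c and |v| + c' differ by 2, so one of them is twice an odd m. *)
have [t [m [odd_m ot ot' eq_t]]] : exists t m,
    [/\ odd m, occ v t, occ v (t + m.*2) & odd t = odd s].
  have mE : (size v + c)./2.*2 = size v + c by rewrite even_halfK.
  have [odd_m|even_m] := boolP (odd (size v + c)./2).
    by exists s, (size v + c)./2; split; rewrite // mE addnA.
  exists s', (size v + c)./2.+1; split; rewrite // doubleS mE.
  by rewrite -!addnS -c'E addnA.
(* Of two odd positions at distance 2m with m odd, one has an even half and therefore carries a
   1. *)
have alt j : j < size v -> odd (s + j) -> nth false v j.
  rewrite oddD -eq_t -oddD => lt_j odd_j.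
  have [odd_h|even_h] := boolP (odd (t + j)./2); last first.
    by rewrite -(occ_nth ot lt_j) d_odd // d_even.
  rewrite -(occ_nth ot' lt_j) addnAC d_odd; last by rewrite oddD odd_double addbF.
  rewrite d_even // halfD odd_double andbF doubleK add0n.
  by rewrite oddD odd_h odd_m.
have v_nil : v != [::] by case: (v) v1.
(* Now c is 0 or 1. For c = 1, v follows 000 in the other occurrence and so begins with 1; hence s
   is odd and the gap letter sits at an even position. *)
have odd_s : c = 1 -> odd s.
  move=> c1; have c'3E : c' = 3 by rewrite c'E c1.
  have h : head false v.
    apply: (@head_after_zeros v (s' + size v) v_nil).
    by move: oz o4; rewrite c'3E /= => /and4P[-> -> -> _]; rewrite !addnS addn0.
  exact: d_true_odd (d_head h o1).
have d1 r : odd r -> s <= r < s + size v + c + size v -> d r.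
  move=> odd_r /andP[ge_r lt_r].
  have in_v u : occ v u -> odd u = odd s -> u <= r < u + size v -> d r.
    move=> ou eq_u /andP[ge_u lt_u]; have lt_j : r - u < size v by rewrite ltn_subLR.
    rewrite -(subnKC ge_u) (occ_nth ou lt_j) alt //.
    by rewrite oddD -eq_u -oddD subnKC.
  have [lt1|ge1] := ltnP r (s + size v); first by apply: (in_v s); rewrite ?ge_r.
  have [lt2|ge2] := ltnP r (s + size v + c); last by apply: (in_v _ o2); rewrite ?ge2.
  have c1 : c = 1 by move: ge1 lt2 c'3; rewrite c'E; clear; lia.
  by move: (odd_s c1) lt2 ge1 p12 odd_r; rewrite c1; clear; lia.
(* Since 11 is not a factor, the excluded values of v leave |v| at least 3, and at least 4 by parity
   when c = 0. *)
have long : 7 <= size v + c + size v.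
  have : (size v != 1) && (size v != 2).
    case: (v) v1 nv o1 => [|[] [|[] [|]]] //= _ _.
    by case/and3P=> /eqP/d_true_odd s1 /eqP/d_true_odd /=; rewrite s1.
  have : 0 < size v by rewrite lt0n size_eq0.
  by move: even_c c'3; rewrite c'E; clear; lia.
(* The 1s at r, r + 2, r + 4, r + 6 desubstitute to 0000 at r/2. *)
pose r := if odd s then s else s.+1.
have odd_r : odd r by rewrite /r; case: ifP => //= ->.
have le_r : s <= r by rewrite /r; case: ifP.
have lt_r : r + 6 < s + size v + c + size v.
  rewrite /r; case: (boolP (odd s)) => [_|even_s]; first by move: long; clear; lia.
  have : c != 1 by apply: contraNneq even_s.
  by move: long even_c c'3; rewrite c'E; clear; lia.
have h0 k : k <= 3 -> d (r./2 + k) = false.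
  move=> le_k; have : d (r + k.*2) by apply: d1; move: odd_r le_r lt_r le_k; clear; lia.
  rewrite d_odd ?oddD ?odd_double ?addbF // halfD odd_double andbF add0n doubleK.
  by move/negbTE.
have := no_four_zeros r./2.
by rewrite -(addn0 r./2) -!addnS !h0.
Qed.

(** * Patterns with g(0) = 0 and a 1 in g(1) *)

Section UnitZero.

Variable g : morphism.
Hypotheses (g_ne : nonerasing g) (g0 : g false = [:: false]).
Hypothesis g11 : true \in g true.
Local Notation v := (g true).

Lemma g1_nil : v != [::]. Proof. by apply/eqP/g_ne. Qed.

Lemma apply_gap c : apply g (true :: nseq c false ++ [:: true]) = v ++ nseq c false ++ v.
Proof. by rewrite -cat1s !apply_cat apply_nseq0 // /apply /= cats0. Qed.

Lemma gap_even c t :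
  occ (apply g (true :: nseq c false ++ [:: true])) t -> ~~ odd (size v + c).
Proof.
rewrite apply_gap !occ_cat size_nseq => /and3P[o1 _ o2].
by have := occ_parity g11 o1 o2; lia.
Qed.

Lemma head_g1 t : occ (apply g [:: false; false; false; true]) t -> head false v.
Proof. by rewrite /apply /= g0 cats0; apply: head_after_zeros g1_nil. Qed.

Lemma last_g1 t : occ (apply g [:: true; false; false; false]) t -> last false v.
Proof. by rewrite /apply /= g0; apply: last_before_zeros g1_nil. Qed.

Lemma odd_g1 t : occ (apply g [:: true]) t -> head false v -> last false v -> odd (size v).
Proof. by rewrite /apply /= cats0; apply: odd_between_ones. Qed.

(* The 000 on both sides force v to begin and end with 1, hence to have odd length. *)
Lemma no_even_framed_gap (l : word) c t : ~~ odd c ->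
  all (fun x : word => infix x l)
    [:: [:: false; false; false; true]; [:: true; false; false; false];
        true :: nseq c false ++ [:: true]] ->
  ~~ occ (apply g l) t.
Proof.
move=> even_c /and4P[i1 i2 i3 _]; apply/negP => occ_l.
have [t1 /head_g1 hv] := occ_infix occ_l i1.
have [t2 o2] := occ_infix occ_l i2; have lv := last_g1 o2.
have [t3 /gap_even] := occ_infix occ_l i3.
have [t4 /odd_g1 /(_ hv lv)] := occ_infix o2 (isT : infix [:: true] [:: true; false; false; false]).
by rewrite oddD => ->; rewrite (negbTE even_c).
Qed.

(* The 0s two places before the first v and two places after the second are at odd
   positions, so they desubstitute to 1s at an odd distance. *)
Lemma no_00v0v00 t : odd (size v) -> head false v ->
  ~~ occ (apply g [:: false; false; true; false; true; false; false]) t.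
Proof.
move=> odd_v hv; apply/negP; rewrite /apply /= g0 /= => /and3P[/eqP d0 _].
rewrite occ_cat => /andP[o1] /= /andP[_]; rewrite occ_cat => /andP[_] /= /and3P[_ /eqP de _].
have /d_true_odd odd_t := d_head hv o1.
rewrite /= negbK in odd_t.
have odd_h : odd t./2 by apply/d_true_odd/negbNE; rewrite -d_odd ?d0.
rewrite d_odd in de; last by lia.
by move/negbFE/d_true_odd: de; lia.
Qed.

Lemma no_00101000 t :
  ~~ occ (apply g [:: false; false; true; false; true; false; false; false]) t.
Proof.
set l := (X in apply g X); apply/negP => occ_l.
have [t1 o1] := occ_infix occ_l
  (isT : infix [:: true; false; false; false] l).
have lv := last_g1 o1.
have [t2 /(@gap_even 1) even_v] := occ_infix occ_l
  (isT : infix [:: true; false; true] l).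
have odd_v : odd (size v) by lia.
have [hv|] := boolP (head false v).
  have [t3] := occ_infix occ_l
    (isT : infix [:: false; false; true; false; true; false; false] l).
  exact/negP/no_00v0v00.
have [t4] := occ_infix occ_l
  (isT : infix [:: false; false; true] l).
(* If v = 0w, then 00v = 000w makes w begin with 1. It also ends with 1, so |w| is odd and |v| even,
   a contradiction. *)
rewrite /apply /= g0 cats0; case def_v: v g11 => [|[] w] //; rewrite inE /= => w1 o4 _.
have nw : w != [::] by case: (w) w1.
have hw := head_after_zeros nw o4.
have lw : last false w by move: lv; rewrite def_v; case: (w) nw.
case/and4P: o4 => _ _ _ /odd_between_ones /(_ hw lw).
by move: odd_v; rewrite def_v /= => /negbTE ->.
Qed.

(** Here 000v makes v begin with 1 and v0v makes |v| odd, which reduces to [no_00v0v00]. *)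
Lemma no_00010100 t :
  ~~ occ (apply g [:: false; false; false; true; false; true; false; false]) t.
Proof.
set l := (X in apply g X); apply/negP => occ_l.
have [t1 o1] := occ_infix occ_l
  (isT : infix [:: false; false; false; true] l).
have hv := head_g1 o1.
have [t2 /(@gap_even 1) even_v] := occ_infix occ_l
  (isT : infix [:: true; false; true] l).
have odd_v : odd (size v) by lia.
have [t3] := occ_infix occ_l
  (isT : infix [:: false; false; true; false; true; false; false] l).
exact/negP/no_00v0v00.
Qed.

(* In the next two lemmas the missing letter of a fourth power is a 0 by parity. *)
Lemma no_100010001000100 t :
  ~~ occ (apply g [:: true; false; false; false; true; false; false; false;
                      true; false; false; false; true; false; false]) t.
Proof.
set l := (X in apply g X); apply/negP => occ_l.
have [t2 /(@gap_even 3) even_v] := occ_infix occ_l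
  (isT : infix [:: true; false; false; false; true] l).
have [t1 /head_g1 hv] := occ_infix occ_l
  (isT : infix [:: false; false; false; true] l).
have /d_true_odd odd_t : d t.
  by move: occ_l; rewrite /apply /= occ_cat => /andP[/(d_head hv)].
have := @no_fourth_power_apply g [:: true; false; false; false] t g_ne isT.
rewrite -[_ ++ _]/(l ++ [:: false]) apply_cat occ_cat occ_l /= {1}/apply /= g0 /=.
rewrite d_even //= /l /apply /= g0.
by do !rewrite size_cat /=; lia.
Qed.

Lemma no_001000100010001 t :
  ~~ occ (apply g [:: false; false; true; false; false; false; true;
     false; false; false; true; false; false; false; true]) t.
Proof.
set l := (X in apply g X); apply/negP => occ_l.
have [t1 /head_g1 hv] := occ_infix occ_l
  (isT : infix [:: false; false; false; true] l).
have /d_true_odd odd_t : d t.+2.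
  move: occ_l; rewrite /apply /= g0 /= => /and3P[_ _].
  by rewrite occ_cat => /andP[/(d_head hv)].
case: t odd_t occ_l => // t odd_t occ_l.
have := @no_fourth_power_apply g [:: false; false; false; true] t g_ne isT.
rewrite -[_ ++ _]/(false :: l) /apply /= g0 /= d_even //=.
  by move: occ_l; rewrite /apply /= g0 /= => ->.
by move: odd_t; rewrite /= negbK.
Qed.

(** All gaps between consecutive 1s of p equal one c, at most 3 because 0000 is excluded. So p is a
    factor of a power of 10^c with up to three 0s at each end. In each of the four cases the
    forbidden factors bound the length of p. *)
Lemma tame_unit_zero p s : occ (apply g p) s ->
  v \notin [:: [:: true]; [:: false; true]; [:: true; false]] -> tame p.
Proof.
move=> occ_p nv; pose gap c := true :: nseq c false ++ [:: true].
have [c c3 gap_c] : exists2 c, c <= 3 &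
    forall c', c' != c -> c' <= 3 -> ~~ infix (gap c') p.
  have [/hasP[c]|/hasPn no_gap] := boolP (has (fun c => infix (gap c) p) (iota 0 4)).
    rewrite mem_iota => c3 /(occ_infix occ_p)[t]; rewrite apply_gap => occ_c.
    exists c => // c' ne_c _; apply: contra ne_c => /(occ_infix occ_p)[t'].
    rewrite apply_gap => occ_c'; rewrite eqn_leq.
    by rewrite (gap_le g11 nv occ_c occ_c') (gap_le g11 nv occ_c' occ_c).
  (* No gap occurs at all, so any c would serve. *)
  by exists 0 => // c' _ c'3; apply: no_gap; rewrite mem_iota.
have no4 x : x != [::] -> ~~ infix (x ++ x ++ x ++ x) p.
  by move=> nx; apply: (not_infix occ_p) => t; apply: no_fourth_power_apply.
have no0 := no4 [:: false] isT.
case: c c3 gap_c => [|[|[|[|]]]] // _ gap_c.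
- apply: (@avoids_tame [:: gap 1; gap 2; gap 3; nseq 4 false; nseq 4 true;
    [:: false; false; false; true; true; true; false; false; false]] 9).
    by vm_compute.
  do !apply: avoids_cons => //; try exact: gap_c.
    exact: (no4 [:: true]).
  by apply: (not_infix occ_p) => t; apply: (@no_even_framed_gap _ 0).
- apply: (@avoids_tame [:: gap 0; gap 2; gap 3; nseq 4 false;
    [:: true; false; true; false; true; false; true; false];
    [:: false; true; false; true; false; true; false; true];
    [:: false; false; true; false; true; false; false; false];
    [:: false; false; false; true; false; true; false; false]] 12).
    by vm_compute.
  do !apply: avoids_cons => //; try exact: gap_c.
  + exact: (no4 [:: true; false]).
  + exact: (no4 [:: false; true]).
  + exact: (not_infix occ_p no_00101000).
  + exact: (not_infix occ_p no_00010100).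
- apply: (@avoids_tame [:: gap 0; gap 1; gap 3; nseq 4 false;
    [:: true; false; false; true; false; false; true; false; false; true; false; false];
    [:: false; true; false; false; true; false; false; true; false; false; true; false];
    [:: false; false; true; false; false; true; false; false; true; false; false; true];
    [:: false; false; false; true; false; false; true; false; false; false];
    [:: false; false; false; true; false; false; true; false; false; true;
        false; false; false]] 13).
    by vm_compute.
  do !apply: avoids_cons => //; try exact: gap_c.
  + exact: (no4 [:: true; false; false]).
  + exact: (no4 [:: false; true; false]).
  + exact: (no4 [:: false; false; true]).
  + by apply: (not_infix occ_p) => t; apply: (@no_even_framed_gap _ 2).
  + by apply: (not_infix occ_p) => t; apply: (@no_even_framed_gap _ 2).
- apply: (@avoids_tame [:: gap 0; gap 1; gap 2; nseq 4 false;
    [:: true; false; false; false; true; false; false; false;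
        true; false; false; false; true; false; false];
    [:: false; false; true; false; false; false; true; false;
        false; false; true; false; false; false; true]] 16).
    by vm_compute.
  do !apply: avoids_cons => //; try exact: gap_c.
    exact: (not_infix occ_p no_100010001000100).
  exact: (not_infix occ_p no_001000100010001).
Qed.

End UnitZero.

(** * Odd-length g(0) without a 1, and the forward direction *)

Lemma tame_odd_zero g p s : nonerasing g -> occ (apply g p) s ->
  true \notin g false -> odd (size (g false)) -> tame p.
Proof.
move=> ne occ_p g01 odd0.
(* If g(1) has no 1 either, g(p) is a run of at most three zeros, and p is no longer than it. *)
have [g11|g11] := boolP (true \in g true); last first.
  have /zero_run /(_ occ_p) le3 : true \notin apply g p.
    apply/negP => /flattenP[w /mapP[a _ ->]].
    by apply/negP; case: a.
  have le_p : size p <= 3.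
    apply: leq_trans le3; elim: (p) => //= a q IH; rewrite /apply /= size_cat.
    by rewrite -add1n leq_add // lt0n size_eq0; apply/eqP/ne.
  by apply: tamebP; move: p le_p {occ_p le3} => [|[] [|[] [|[] [|]]]] // _; vm_compute.
have no4 x : x != [::] -> ~~ infix (x ++ x ++ x ++ x) p.
  by move=> nx; apply: (not_infix occ_p) => t; apply: no_fourth_power_apply.
have [p0|p0] := boolP (infix [:: false] p); last first.
  apply: (@avoids_tame [:: [:: false]; nseq 4 true] 4); first by vm_compute.
  by do !apply: avoids_cons => //; apply: (no4 [:: true]).
have [t] := occ_infix occ_p p0; rewrite /apply /= cats0 => /(zero_run g01).
(* Odd length and at most three zeros leave g(0) = 0 or g(0) = 000. *)
case def_g0: (g false) odd0 g01 => [|a [|b [|c []]]] //= _; rewrite !inE ?negb_or.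
  case: a def_g0 => // g0 _ _.
  have [|nv] := boolP (g true \in [:: [:: true]; [:: false; true]; [:: true; false]]);
    last exact: tame_unit_zero g0 g11 _ _ occ_p nv.
  have fac h : g =1 h -> factor (apply h p) d.
    by move=> eq_h; apply/factorP; exists s; rewrite /apply -(eq_map eq_h).
  (* For v = 1, 01, 10 the morphism g is the identity, [h1] or [h2]. *)
  rewrite !inE => g1; left; exists p; auto; case/or3P: g1 => /eqP g1.
  - apply: Or31; suff <- : apply (fun a => [:: a]) p = p by apply: fac; case.
    by rewrite /apply flatten_seq1.
  - by apply: Or32; apply: fac; case.
  - by apply: Or33; apply: fac; case.
case: a b c def_g0 => [] [] [] // g0 _ _.
have no00 u : ~~ occ (apply g [:: false; false]) u.
  apply/negP => /zero_run; rewrite /apply /= g0 /= => h.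
  by have := h isT.
have [odd1|even1] := boolP (odd (size (g true))).
  apply: (tame_alternating ne occ_p) => -[] u; last exact: no00.
  by apply: (@no_odd_repeat g true [::]); rewrite // /apply /= cats0.
(* With g(0) = 000 and |v| even, 101 would repeat v at the odd distance |v| + 3. *)
apply: (@avoids_tame [:: [:: false; false]; nseq 4 true; [:: true; false; true]] 6).
  by vm_compute.
do !apply: avoids_cons => //.
- exact: (not_infix occ_p no00).
- exact: (no4 [:: true]).
apply: (not_infix occ_p) => u; apply: (@no_odd_repeat g true [:: false]) => //.
by rewrite /apply /= g0 size_cat oddD (negbTE even1).
Qed.

(** Exchanging the letters of g while complementing p lets the letter with odd-length image be 0. *)
Lemma encounters_tame p : encounters d p -> tame p.
Proof.
case/encounters_reduced=> g [s [ne occ_p odd_g]].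
have ne_swap : nonerasing (g \o negb) by move=> a; apply: ne.
have occ_swap : occ (apply (g \o negb) (complement p)) s by rewrite apply_complement.
have [/existsP[[] /andP[odd_a a0]]|/existsPn no_zero] :=
    boolP [exists a, odd (size (g a)) && (true \notin g a)].
- exact/tame_complement/(tame_odd_zero ne_swap occ_swap).
- exact: tame_odd_zero occ_p _ _.
have g1 a : odd (size (g a)) -> true \in g a.
  by move=> odd_a; have := no_zero a; rewrite odd_a negbK.
case: odd_g => -[] odd_a.
  exact/tame_complement/(tame_both_true ne_swap occ_swap (g1 _ odd_a) odd_a (@g1 false)).
exact: (tame_both_true ne occ_p (g1 _ odd_a) odd_a (@g1 true)).
Qed.

(** * The converse direction and mutual exclusion *)

Lemma encounters_complement p : encounters d (complement p) -> encounters d p.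
Proof.
case=> g ne fac; exists (g \o negb) => [a|]; first exact: ne.
by rewrite -(complementK p) apply_complement.
Qed.

Lemma exceptional_encounters p : p \in exceptional_patterns -> encounters d p.
Proof.
move=> exc_p.
pose g v : morphism := fun a => if a then v else [:: false].
(* With g(0) = 0, one of these four alternating words as g(1) places each exceptional pattern within
   the first 64 letters. *)
have : has (fun v => infix (apply (g v) p) short_prefix)
    [:: [:: false; true; false]; [:: false; true; false; true; false; true];
        [:: true; false; true; false; true; false]; [:: true; false; true; false; true]].
  by move: p exc_p; apply/allP; vm_compute.
case/hasP=> v in_v /infix_factor fac; exists (g v) => // -[] //= v0.
by move: in_v; rewrite v0.
Qed.

(* [possible n w] tries both parities for an occurrence of w, then desubstitutes
   n times; it is a necessary condition for w to be a factor. *)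
Fixpoint zeros_at (b : bool) (w : word) : bool :=
  if w is a :: w' then (b || ~~ a) && zeros_at (~~ b) w' else true.

Fixpoint possible (n : nat) (w : word) : bool :=
  if n is n'.+1 then has (fun b => zeros_at b w && possible n' (undelta (~~ b) w))
                         [:: false; true]
  else true.

Lemma occ_zeros_at w s : occ w s -> zeros_at (odd s) w.
Proof.
elim: w s => //= a w IH s /andP[/eqP <- /IH ->]; rewrite andbT.
by have [//|/d_even ->] := boolP (odd s).
Qed.

Lemma factor_possible n w : factor w d -> possible n w.
Proof.
case/factorP=> s; elim: n w s => //= n IH w s occ_w.
have := occ_zeros_at occ_w; have := IH _ _ (occ_undelta occ_w).
by case: (odd s) => -> -> //; rewrite orbT.
Qed.

Lemma exceptional_not_factor e q : e \in exceptional_patterns ->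
  q \in [:: e; complement e] ->
  ~ [\/ factor q d, factor (apply h1 q) d | factor (apply h2 q) d].
Proof.
move=> exc_e in_q fac.
(* Six rounds of desubstitution refute all these words by computation. *)
have : ~~ [|| possible 6 q, possible 6 (apply h1 q) | possible 6 (apply h2 q)].
  by move: q in_q {fac}; apply/allP; move: e exc_e; apply/allP; vm_compute.
by case: fac => /(factor_possible 6) ->; rewrite ?orbT.
Qed.

Theorem theorem5p3 (p : word) :
  (encounters period_doubling p <->
     (exists2 q : word, q = p \/ q = complement p &
        [\/ factor q period_doubling,
            factor (apply h1 q) period_doubling
          | factor (apply h2 q) period_doubling])
     \/ (p \in exceptional_patterns \/ complement p \in exceptional_patterns))
  /\
  ~ ((exists2 q : word, q = p \/ q = complement p &
        [\/ factor q period_doubling,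
            factor (apply h1 q) period_doubling
          | factor (apply h2 q) period_doubling])
     /\ (p \in exceptional_patterns \/ complement p \in exceptional_patterns)).
Proof.
split; [split; first exact: encounters_tame|].
  have enc q : [\/ factor q d, factor (apply h1 q) d | factor (apply h2 q) d] ->
      encounters d q.
    case=> fac; [exists (fun a => [:: a])|exists h1|exists h2] => //; try by case.
    by rewrite /apply flatten_seq1.
  case=> [[q [->|->] fac]|[]].
  - exact: enc.
  - exact/encounters_complement/enc.
  - exact: exceptional_encounters.
  - by move/exceptional_encounters/encounters_complement.
case=> -[q eq_q fac] [exc_p|exc_cp].
  by apply: (exceptional_not_factor exc_p _ fac); case: eq_q => ->; rewrite !inE eqxx ?orbT.
apply: (exceptional_not_factor exc_cp _ fac).
by rewrite complementK; case: eq_q => ->; rewrite !inE eqxx ?orbT.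
Qed.
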